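(* Let $\mathcal{P}$ be a collection of probability distributions on $\mathcal{Z}^{n+1}$, let $\mathcal{E}:\mathcal{Z}^{n+1}\to[0,\infty]$ be a fuzzy prediction set that is valid for $\mathcal{P}$, and let $\overline{C}_\alpha^{Z^n}=\{z\in\mathcal{Z}:\mathcal{E}^{Z^n}(z)<1/\alpha\}$ for $\alpha>0$. Let $L_z:\mathcal{D}\to\mathbb{R}$, $z\in\mathcal{Z}$, be a loss function on a decision space $\mathcal{D}$. For every $Z^n$-dependent decision rule $\delta$ and every data-dependent level $\widetilde{\alpha}$, $$\mathrm{E}_{\widetilde{\alpha}}^P\left[\frac{P\left(L_{Z_{n+1}}(\delta)>\sup_{z\in\overline{C}_{\widetilde{\alpha}}^{Z^n}}L_z(\delta)\;\middle|\;\widetilde{\alpha}\right)}{\widetilde{\alpha}}\right]\le1,\quad\text{for every }P\in\mathcal{P}.$$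
   Context: $\mathcal{Z}$ is a measurable sample space and $Z^{n+1}=(Z^n,Z_{n+1})$ denotes a random element of $\mathcal{Z}^{n+1}$. A fuzzy prediction set is a measurable map $\mathcal{E}:\mathcal{Z}^{n+1}\to[0,\infty]$, with $\mathcal{E}^{z^n}(z)=\mathcal{E}(z^n,z)$; it is valid for $\mathcal{P}$ if $\mathrm{E}^P[\mathcal{E}^{Z^n}(Z_{n+1})]\le1$ for every $P\in\mathcal{P}$. A $Z^n$-dependent decision rule is a (measurable) map $\delta$ from $\mathcal{Z}^n$ to $\mathcal{D}$, with $\delta$ also denoting $\delta(Z^n)$. A data-dependent level $\widetilde{\alpha}$ is a $(0,\infty)$-valued measurable function of $Z^{n+1}$. The supremum over the empty set is $-\infty$. The event in question is assumed measurable. $\mathrm{E}^P_{\widetilde\alpha}$ is the expectation over $\widetilde{\alpha}$ when $Z^{n+1}\sim P$. *)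

(* Defs.v *)
From HB Require Import structures.
From mathcomp Require Import all_boot all_order all_algebra.
From mathcomp Require Import all_classical all_reals all_analysis.
From mathcomp Require Import measurable_realfun.

Set Implicit Arguments.
Unset Strict Implicit.
Unset Printing Implicit Defensive.

Import Order.TTheory GRing.Theory Num.Theory.
Import numFieldNormedType.Exports.

Local Open Scope classical_set_scope.
Local Open Scope ring_scope.
Local Open Scope ereal_scope.

(* A point of Z^(n+1) is an n.+1.-tuple, with the product sigma-algebra;
   rcons_init_last identifies it with the pair (Z^n, Z_(n+1)). *)

Section sample.
Context {d : measure_display} {Z : measurableType d} {n : nat}.

Definition init_obs (t : n.+1.-tuple Z) : n.-tuple Z :=
  [tuple tnth t (widen_ord (leqnSn n) i) | i < n].

Definition last_obs (t : n.+1.-tuple Z) : Z := tnth t ord_max.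

Lemma rcons_init_last (t : n.+1.-tuple Z) :
  [tuple of rcons (init_obs t) (last_obs t)] = t.
Proof.
apply: eq_from_tnth => i; rewrite (tnth_nth (last_obs t)) /= nth_rcons size_map.
rewrite size_enum_ord; case: ltngtP => [lt_in|gt_in|eq_in].
- have -> : nth (last_obs t) (init_obs t) i
          = tnth (init_obs t) (Ordinal lt_in) by rewrite (tnth_nth (last_obs t)).
  by rewrite tnth_mktuple; congr tnth; exact: val_inj.
- by have := ltn_ord i; rewrite ltnS leqNgt gt_in.
- by rewrite /last_obs; congr tnth; exact: val_inj.
Qed.

Context {R : realType}.
Implicit Types E : n.+1.-tuple Z -> \bar R.

Definition fuzzy_prediction_set E : Prop :=
  measurable_fun [set: n.+1.-tuple Z] E /\ forall t, 0 <= E t.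

Definition fuzzy_at E (zn : n.-tuple Z) (z : Z) : \bar R :=
  E [tuple of rcons zn z].

Definition valid_for (PP : set (probability (n.+1.-tuple Z) R)) E : Prop :=
  forall P, PP P -> \int[P]_t fuzzy_at E (init_obs t) (last_obs t) <= 1.

Definition level_set E (alpha : R) (zn : n.-tuple Z) : set Z :=
  [set z | fuzzy_at E zn z < (1 / alpha)%:E].

(* The supremum is taken in \bar R, where ereal_sup set0 = -oo. *)
Definition loss_exceeds {D : Type} (L : Z -> D -> R) (delta : n.-tuple Z -> D)
    E (alpha : n.+1.-tuple Z -> R) : set (n.+1.-tuple Z) :=
  [set t | ereal_sup [set (L z (delta (init_obs t)))%:E
                     | z in level_set E (alpha t) (init_obs t)]
           < (L (last_obs t) (delta (init_obs t)))%:E].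

End sample.

(* g is a version of x |-> P(A | X = x), in Kolmogorov's sense; P(A | X) is
   then g \o X.  Versions are unique up to a null set for the law of X. *)
Definition cond_prob_version {d : measure_display} {T : measurableType d}
    {R : realType} (P : probability T R) (X : {mfun T >-> R}) (A : set T)
    (g : R -> \bar R) : Prop :=
  (distribution P X).-integrable setT g /\
  forall B : set R, measurable B ->
    \int[distribution P X]_(x in B) g x = P (A `&` X @^-1` B).

Lemma cond_prob_version_exists {d : measure_display} {T : measurableType d}
    {R : realType} (P : probability T R) (X : {mfun T >-> R}) (A : set T) :
  measurable A -> exists g, cond_prob_version P X A g.
Proof.
move=> mA.
have mX : measurable_fun setT X by exact: measurable_funPT.
pose nuA : {charge set T -> \bar R} := crestr0 (charge_of_finite_measure P) mA.
pose nu : {charge set _ -> \bar R} := pushforward nuA X.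
have mXB (B : set R) : measurable B -> measurable (X @^-1` B).
  by move=> mB; rewrite -[Y in measurable Y]setTI; exact: mX.
have nuE (B : set R) : measurable B -> nu mX B = P (A `&` X @^-1` B).
  move=> mB; rewrite /nu /= /pushforward /nuA /= /crestr0 mem_set//=; last exact: mXB.
  by rewrite /crestr setIC.
have nudom : nu mX `<< distribution P X.
  apply/null_content_dominatesP => B mB PB0; rewrite nuE//.
  apply/eqP; rewrite eq_le measure_ge0 andbT -PB0 le_measure ?inE//.
  - by apply: measurableI => //; exact: mXB.
  - exact: mXB.
exists (Radon_Nikodym (nu mX) (distribution P X)); split.
  exact: Radon_Nikodym_integrable.
by move=> B mB; rewrite -Radon_Nikodym_integral// nuE.
Qed.

(* Main.v *)
(* On the event the point Z_(n+1) lies outside the level set, for otherwise the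
   supremum would be at least its loss; hence 1/alpha <= E there.  A version g of
   the conditional probability given alpha is the density, with respect to the
   law of alpha, of B |-> P(event /\ alpha \in B), so the integral of g(a)/a is
   the P-integral of 1/alpha over the event, which is at most that of E. *)
Require Import Defs.
From HB Require Import structures.
From mathcomp Require Import all_boot all_order all_algebra.
From mathcomp Require Import all_classical all_reals all_analysis.
From mathcomp Require Import measurable_realfun.

Import Order.TTheory GRing.Theory Num.Theory.
Import numFieldNormedType.Exports.

Local Open Scope classical_set_scope.
Local Open Scope ring_scope.
Local Open Scope ereal_scope.

(** Inversion is continuous on the open complement of 0, and any function is measurable on a
    singleton. *)
Lemma measurable_invr (R : realType) :
  measurable_fun [set: R] (fun x : R => x^-1)%R.
Proof.
have m0 : measurable [set 0%R : R] by exact: measurable_set1.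
rewrite -(setUv [set 0%R : R]); apply/measurable_funU => //.
  exact: measurableC.
split; first exact: measurable_fun_set1.
apply: open_continuous_measurable_fun.
  by rewrite openC; exact/accessible_closed_set1/hausdorff_accessible/Rhausdorff.
by move=> x /[!inE] /eqP x0; exact: inv_continuous.
Qed.

Lemma integral_mrestr (d : measure_display) (T : measurableType d)
    (R : realType) (mu : {measure set T -> \bar R}) (A : set T)
    (mA : measurable A) (f : T -> \bar R) :
  measurable_fun [set: T] f ->
  \int[mrestr mu mA]_x f x = \int[mu]_(x in A) f x.
Proof.
move=> mf; have nuA0 : mrestr mu mA (~` A) = 0.
  by rewrite /mrestr setICl measure0.
rewrite -(setUv A) integral_setU//.
- rewrite [X in _ + X](null_set_integral _ (measurable_funTS mf))// ?adde0.
  + apply: eq_measure_integral => B mB BA.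
    by rewrite /= /mrestr setIidl.
  + exact: measurableC.
- exact: measurableC.
- by rewrite setUv.
- by apply/disj_setPCl.
Qed.

(** Both [g] and the Radon-Nikodym derivative of [nu] integrate to [nu B] over every measurable [B],
    so they agree [mu]-almost everywhere and the change of variables passes from one to the
    other. *)
Lemma density_change_of_variables (d : measure_display) (T : measurableType d)
    (R : realType) (mu : {sigma_finite_measure set T -> \bar R})
    (nu : {finite_measure set T -> \bar R}) (g f : T -> \bar R) :
  mu.-integrable [set: T] g ->
  (forall B, measurable B -> \int[mu]_(x in B) g x = nu B) ->
  nu.-integrable [set: T] f ->
  \int[mu]_x (g x * f x) = \int[nu]_x f x.
Proof.
move=> ig gE inf; have mf := measurable_int _ inf.
have mg := measurable_int _ ig.
have numu : nu `<< mu.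
  apply/null_content_dominatesP => B mB muB0; rewrite -gE//.
  exact: null_set_integral (measurable_funTS mg) _.
have ae_g : ae_eq mu [set: T] g (Radon_Nikodym (charge_of_finite_measure nu) mu).
  apply: integral_ae_eq => // B _ mB.
  by rewrite gE// -Radon_Nikodym_integral.
rewrite -(Radon_Nikodym_change_of_variables numu)//.
apply: ae_eq_integral => //; try exact: emeasurable_funM.
by apply: filterS ae_g => x /[apply] ->; rewrite muleC.
Qed.

(** Restricting [P] to [A] and pushing forward along [X] gives a finite measure whose density with
    respect to the law of [X] is [g]. *)
Lemma cond_prob_version_integral (d : measure_display) (T : measurableType d)
    (R : realType) (P : probability T R) (X : {mfun T >-> R}) (A : set T)
    (g f : R -> \bar R) :
  measurable A -> cond_prob_version P X A g ->
  measurable_fun [set: R] f -> P.-integrable A (f \o X) ->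
  \int[distribution P X]_a (g a * f a) = \int[P]_(t in A) f (X t).
Proof.
move=> mA [ig gE] mf iAf.
have mX : measurable_fun [set: T] X by exact: measurable_funPT.
have mfX : measurable_fun [set: T] (f \o X) by exact: measurableT_comp.
pose PA := mrestr P mA.
have iPA : PA.-integrable [set: T] (f \o X).
  apply/integrableP; split => //; rewrite integral_mrestr//.
    by case/integrableP : iAf.
  exact: measurableT_comp.
(* The total mass of this measure is [P A], which is finite. *)
have [law lawE] : exists law : {measure set R -> \bar R},
    law = pushforward PA X :> (set R -> \bar R).
  by unshelve eexists (pushforward PA X).
have law_lty : law setT < +oo.
  rewrite lawE /pushforward preimage_setT /PA /mrestr setTI.
  by rewrite ltey_eq fin_num_measure.
(* Restricting to the whole space equips the measure with the finiteness
   instance that the Radon-Nikodym lemmas require. *)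
pose nu : {finite_measure set R -> \bar R} := mfrestr measurableT law_lty.
have nuE : nu = pushforward PA X :> (set R -> \bar R).
  by rewrite -lawE; apply/funext => B; rewrite /nu /= /mfrestr /mrestr setIT.
rewrite (density_change_of_variables _ _ _ _ nu)//.
- by rewrite nuE integral_pushforward// integral_mrestr.
- by move=> B mB; rewrite gE// nuE /pushforward /PA /mrestr setIC.
- by rewrite nuE; exact: integrable_pushforward.
Qed.

(** The bound is pointwise in [t], so [alpha] may depend on the whole sample, the last observation
    included. *)
Lemma loss_exceeds_le_fuzzy (d : measure_display) (Z : measurableType d)
    (n : nat) (R : realType) (D : Type) (L : Z -> D -> R)
    (delta : n.-tuple Z -> D) (E : n.+1.-tuple Z -> \bar R)
    (alpha : n.+1.-tuple Z -> R) (t : n.+1.-tuple Z) :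
  loss_exceeds L delta E alpha t -> ((alpha t)^-1)%:E <= E t.
Proof.
move=> exc; rewrite -[E t](congr1 E (rcons_init_last t)) leNgt.
apply: contraTN exc.
rewrite -leNgt => Elt; apply: ereal_sup_ubound.
by exists (last_obs t) => //=; rewrite /level_set /= div1r.
Qed.

Theorem proposition4 (R : realType) (d d' : measure_display)
  (Z : measurableType d) (D : measurableType d') (n : nat)
  (PP : set (probability (n.+1.-tuple Z) R))
  (E : n.+1.-tuple Z -> \bar R)
  (E_fuzzy : fuzzy_prediction_set E)
  (E_valid : valid_for PP E)
  (L : Z -> D -> R)
  (delta : n.-tuple Z -> D)
  (delta_meas : measurable_fun [set: n.-tuple Z] delta)
  (alpha : {mfun n.+1.-tuple Z >-> R})
  (alpha_gt0 : forall t, (0 < alpha t)%R)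
  (event_meas : measurable (loss_exceeds L delta E alpha)) :
  forall P : probability (n.+1.-tuple Z) R, PP P ->
  forall g : R -> \bar R,
    cond_prob_version P alpha (loss_exceeds L delta E alpha) g ->
    \int[distribution P alpha]_a (g a * (a^-1)%:E) <= 1.
Proof.
move=> P PPP g gP; have [mE E0] := E_fuzzy.
set A := loss_exceeds L delta E alpha in event_meas gP.
(* The value [0^-1 = 0] is harmless: the law of [alpha] is carried by the positive reals. *)
have mV : measurable_fun [set: R] (fun a : R => (a^-1)%:E).
  by apply/measurable_EFinP; exact: measurable_invr.
have mVa : measurable_fun [set: n.+1.-tuple Z] (fun t => ((alpha t)^-1)%:E).
  exact: (measurableT_comp mV (measurable_funPT alpha)).
have Va0 t : 0 <= ((alpha t)^-1)%:E by rewrite lee_fin invr_ge0 ltW.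
have bound : \int[P]_(t in A) ((alpha t)^-1)%:E <= 1.
  apply: le_trans (E_valid P PPP).
  under [leRHS]eq_integral do rewrite /fuzzy_at rcons_init_last.
  apply: (@le_trans _ _ (\int[P]_(t in A) E t)).
    apply: ge0_le_integral => //; [exact: measurable_funTS..|].
    by move=> t; exact: loss_exceeds_le_fuzzy.
  (* As [E] is nonnegative, enlarging the domain from [A] to the whole space can only increase the
     integral. *)
  exact: ge0_subset_integral.
rewrite (cond_prob_version_integral _ _ _ _ _ _ _ _ event_meas gP mV)//.
(* The integrand is nonnegative, so [bound] also yields its integrability. *)
apply/integrableP; split; first exact: measurable_funTS.
under eq_integral => t _ do rewrite (gee0_abs (Va0 t)).
exact: le_lt_trans bound (ltry _).
Qed.
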